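(* There is a constant $K_0$ such that for all $n\ge 2$, every initial BST on $[n]$ and every sequence of $m$ accesses, the Path-Balance algorithm performs the $m$ accesses with total cost at most $K_0\,(n+m)\log_2 n\,\log_2\log_2 n$; that is, Path-Balance has amortized cost $O(\log n\log\log n)$ per access.
   Context: BSTs on keys $[n]$. The Path-Balance algorithm is a minimally self-adjusting BST algorithm: on access to $s$ in the current tree $T$, with search path $P$ (nodes on the root-to-$s$ path, including $s$), it replaces $P$ by a balanced BST on the node set $P$ of depth $\lceil\log_2(1+|P|)\rceil$ rooted at $s$, reattaching the subtrees hanging off $P$ in the unique order-consistent way. The cost of an access is $|P|$.
   Formalization: The bound is stated for n ≥ 3 instead of n ≥ 2, since at n = 2 the factor log₂ log₂ n is 0 and the claimed bound fails as soon as one access is made. *)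

(* Defs.v *)
From Stdlib Require Import Reals Arith List.
Import ListNotations.

Inductive tree : Type :=
| Leaf : tree
| Node : tree -> nat -> tree -> tree.

Fixpoint keys (t : tree) : list nat :=
  match t with
  | Leaf => []
  | Node l k r => keys l ++ k :: keys r
  end.

Fixpoint bst (t : tree) : Prop :=
  match t with
  | Leaf => True
  | Node l k r =>
      (forall x, In x (keys l) -> x < k) /\
      (forall x, In x (keys r) -> k < x) /\
      bst l /\ bst r
  end.

Definition bst_on (n : nat) (t : tree) : Prop :=
  bst t /\ forall x, In x (keys t) <-> 1 <= x <= n.

Definition root_key (t : tree) : option nat :=
  match t with
  | Leaf => None
  | Node _ k _ => Some k
  end.

Fixpoint levels (t : tree) : nat :=
  match t with
  | Leaf => 0
  | Node l _ r => S (Nat.max (levels l) (levels r))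
  end.

(* Depth counts edges, so a one-node tree has depth 0. *)
Definition depth (t : tree) : nat := Nat.pred (levels t).

Fixpoint search_path (s : nat) (t : tree) : list nat :=
  match t with
  | Leaf => []
  | Node l k r =>
      match Nat.compare s k with
      | Eq => [k]
      | Lt => k :: search_path s l
      | Gt => k :: search_path s r
      end
  end.

(* The (possibly empty) subtrees hanging off the search path, in increasing
   key order; if s occurs in t there is one more of them than path nodes. *)
Fixpoint hanging (s : nat) (t : tree) : list tree :=
  match t with
  | Leaf => [Leaf]
  | Node l k r =>
      match Nat.compare s k with
      | Eq => [l; r]
      | Lt => hanging s l ++ [r]
      | Gt => l :: hanging s r
      end
  end.

(* Replaces the empty subtrees of a, from left to right, by the elements of ts:
   l has one more empty subtree than it has keys. *)
Fixpoint graft (a : tree) (ts : list tree) : tree :=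
  match a with
  | Leaf => hd Leaf ts
  | Node l k r =>
      let j := S (length (keys l)) in
      Node (graft l (firstn j ts)) k (graft r (skipn j ts))
  end.

(* Nat.log2_up (1 + p) is the ceiling of log_2 (1 + p).  The depth is bounded
   rather than prescribed exactly: on {1,2,3} the only tree rooted at 2 has
   depth 1, while every tree rooted at 3 has depth 2.  Any tree a within the
   bound is allowed, so results about the relation cover every rule for
   choosing a. *)
Definition path_balance_step (s : nat) (t t' : tree) : Prop :=
  exists a : tree,
    bst a /\
    (forall x, In x (keys a) <-> In x (search_path s t)) /\
    root_key a = Some s /\
    depth a <= Nat.log2_up (1 + length (search_path s t)) /\
    t' = graft a (hanging s t).

(* The last argument is the total cost of the accesses. *)
Inductive path_balance_run : tree -> list nat -> nat -> Prop :=
| run_nil : forall t, path_balance_run t [] 0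
| run_cons : forall s ss t t' c,
    path_balance_step s t t' ->
    path_balance_run t' ss c ->
    path_balance_run t (s :: ss) (length (search_path s t) + c).

(* Main.v *)
(** Potential: the sum, over all nodes, of the binary logarithm of the subtree
    size.  Fix an access to [s] with path [P], and a node of [P] other than [s];
    let [b] be the size of its new subtree and [lo] the number of keys from [s]
    up to that subtree.  Its old subtree contains [s] and everything in between,
    so it has size at least [lo], and [4 * b * lo <= (lo + b) ^ 2] gives

      [log b - log old + 2 <= 2 * (log (lo + b) - log lo)].

    The right-hand side is additive over adjacent intervals of keys, so it sums
    to at most [2 * log n] on each level of the balanced tree.  As there are
    [O(log |P|)] levels, the amortized cost of the access is at most
    [O(log n * log |P|) - |P|], which is [O(log n * log log n)] for every value
    of [|P|]. *)

Require Import Defs.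
From Stdlib Require Import Reals Arith List.
From Stdlib Require Import Permutation Sorting.Sorted Lra Lia.
Import ListNotations.

(** * Binary logarithms *)

Lemma ln2_pos : (0 < ln 2)%R.
Proof. pose proof ln_lt_2; lra. Qed.

Lemma log2_mult (x y : R) :
  (0 < x)%R -> (0 < y)%R -> Rlog 2 (x * y) = (Rlog 2 x + Rlog 2 y)%R.
Proof.
  intros Hx Hy. unfold Rlog. rewrite ln_mult by assumption.
  pose proof ln2_pos. field. lra.
Qed.

Lemma log2_le (x y : R) : (0 < x)%R -> (x <= y)%R -> (Rlog 2 x <= Rlog 2 y)%R.
Proof.
  intros Hx Hy. unfold Rlog, Rdiv. apply Rmult_le_compat_r.
  - left. apply Rinv_0_lt_compat, ln2_pos.
  - destruct Hy as [Hy | ->]; [left; now apply ln_increasing | lra].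
Qed.

Lemma log2_pow (n : nat) : Rlog 2 (2 ^ n) = INR n.
Proof. apply Rlog_pow; lra. Qed.

Lemma log2_1 : Rlog 2 1 = 0%R.
Proof. exact (log2_pow 0). Qed.

(** Combines [ln x <= x] with [ln 2 > 1/2]. This crude linear bound later absorbs the logarithm of
    the path length into the path length itself. *)
Lemma log2_le_double (x : R) : (0 < x)%R -> (Rlog 2 x <= 2 * x)%R.
Proof.
  intros Hx.
  assert (Hl : (ln x <= x)%R).
  { pose proof (exp_ineq1_le (ln x)) as H. rewrite exp_ln in H by assumption. lra. }
  unfold Rlog. apply Rmult_le_reg_r with (ln 2); [apply ln2_pos|].
  unfold Rdiv. rewrite Rmult_assoc, Rinv_l by (pose proof ln2_pos; lra).
  pose proof ln_lt_2. nra.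
Qed.

(* Junk value: [ln 0 = 0], which makes [Rlog 2] monotone on [nat]. *)
Lemma log2_0 : Rlog 2 0 = 0%R.
Proof.
  unfold Rlog, ln. destruct (Rlt_dec 0 0); [exfalso; lra|]. unfold Rdiv. ring.
Qed.

Lemma log2_INR_nonneg (i : nat) : (0 <= Rlog 2 (INR i))%R.
Proof.
  destruct i as [|i].
  - change (INR 0) with 0%R. rewrite log2_0. lra.
  - rewrite <- log2_1. apply log2_le; [lra|].
    change 1%R with (INR 1). apply le_INR; lia.
Qed.

Lemma log2_INR_le (i j : nat) : i <= j -> (Rlog 2 (INR i) <= Rlog 2 (INR j))%R.
Proof.
  intros H. destruct i as [|i].
  - change (INR 0) with 0%R. rewrite log2_0. apply log2_INR_nonneg.
  - apply log2_le; [apply lt_0_INR; lia | now apply le_INR].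
Qed.

Lemma log2_up_bound (p : nat) :
  1 <= p -> (INR (Nat.log2_up (1 + p)) <= 2 + Rlog 2 (INR p))%R.
Proof.
  intros Hp. destruct (Nat.log2_up_spec (1 + p)) as [H _]; [lia|].
  set (d := Nat.log2_up (1 + p)) in *.
  assert (Hd : (INR d <= 1 + INR (Nat.pred d))%R).
  { destruct d; [simpl; lra | rewrite S_INR; simpl Nat.pred; lra]. }
  assert (Hle : (INR (2 ^ Nat.pred d) <= 2 * INR p)%R).
  { replace 2%R with (INR 2) by reflexivity. rewrite <- mult_INR. apply le_INR; lia. }
  rewrite pow_INR in Hle. simpl INR in Hle at 1.
  assert (0 < INR p)%R by (apply lt_0_INR; lia).
  apply log2_le in Hle; [|apply pow_lt; lra].
  replace (1 + 1)%R with 2%R in Hle by lra.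
  rewrite log2_pow, log2_mult in Hle by lra.
  pose proof (log2_pow 1) as H1. replace (2 ^ 1)%R with 2%R in H1 by lra.
  simpl in H1. lra.
Qed.

(** Logarithmic form of the arithmetic-geometric mean inequality. Its factor 4 becomes the summand
    2, which later pays two units for each path node other than the accessed one. *)
Lemma log2_gain (a b lo hi : nat) :
  1 <= b -> 1 <= lo -> lo <= a -> hi = lo + b ->
  (Rlog 2 (INR b) - Rlog 2 (INR a) + 2
     <= 2 * Rlog 2 (INR hi) - 2 * Rlog 2 (INR lo))%R.
Proof.
  intros Hb Hlo Ha ->.
  pose proof (log2_INR_le lo a Ha) as Hla.
  assert (0 < INR b)%R by (apply lt_0_INR; lia).
  assert (0 < INR lo)%R by (apply lt_0_INR; lia).
  assert (0 < INR b * INR lo)%R by (apply Rmult_lt_0_compat; assumption).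
  assert (0 < INR (lo + b))%R by (apply lt_0_INR; lia).
  assert (H4 : (2 ^ 2 * (INR b * INR lo) <= INR (lo + b) * INR (lo + b))%R).
  { rewrite plus_INR. pose proof (Rle_0_sqr (INR lo - INR b)) as Hsq.
    unfold Rsqr in Hsq. lra. }
  apply log2_le in H4; [|lra].
  rewrite (log2_mult (2 ^ 2)), !log2_mult, log2_pow in H4 by lra.
  simpl INR in H4 at 1. lra.
Qed.

(** * Sorted lists and search trees *)

Lemma StronglySorted_middle (l r : list nat) (k : nat) :
  StronglySorted lt (l ++ k :: r) <->
  (forall x, In x l -> x < k) /\ (forall x, In x r -> k < x) /\
  StronglySorted lt l /\ StronglySorted lt r.
Proof.
  induction l as [|y l IH]; simpl; split.
  - intros H. inversion_clear H as [|? ? Hs Hf]. rewrite Forall_forall in Hf.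
    repeat split; auto using SSorted_nil. tauto.
  - intros (_ & Hr & _ & Hs). constructor; [assumption|]. now apply Forall_forall.
  - intros H. inversion_clear H as [|? ? Hs Hf]. rewrite Forall_forall in Hf.
    apply IH in Hs. destruct Hs as (H1 & H2 & H3 & H4). repeat split; auto.
    + intros x [<-|Hx]; [apply Hf, in_elt | auto].
    + constructor; [assumption|]. apply Forall_forall. intros x Hx.
      apply Hf, in_app_iff. now left.
  - intros (H1 & H2 & H3 & H4). inversion_clear H3 as [|? ? Hs Hf].
    rewrite Forall_forall in Hf. constructor.
    + apply IH. repeat split; auto.
    + apply Forall_forall. intros x Hx. apply in_app_iff in Hx.
      assert (y < k) by auto.
      destruct Hx as [Hx|[<-|Hx]]; auto. specialize (H2 x Hx). lia.
Qed.

Lemma StronglySorted_lt_ext (l1 l2 : list nat) :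
  StronglySorted lt l1 -> StronglySorted lt l2 ->
  (forall x, In x l1 <-> In x l2) -> l1 = l2.
Proof.
  intros H1. revert l2. induction H1 as [|x l1 Hs1 IH Hf1]; intros l2 H2 Hin.
  - destruct l2 as [|y l2]; [reflexivity|]. destruct (proj2 (Hin y)). now left.
  - destruct H2 as [|y l2 Hs2 Hf2]; [destruct (proj1 (Hin x)); now left|].
    rewrite Forall_forall in Hf1, Hf2.
    assert (x = y).
    { destruct (proj1 (Hin x) (or_introl eq_refl)) as [?|Hx]; [auto|].
      destruct (proj2 (Hin y) (or_introl eq_refl)) as [?|Hy]; [auto|].
      specialize (Hf1 _ Hy). specialize (Hf2 _ Hx). lia. }
    subst y. f_equal. apply IH; [assumption|]. intros z. split; intros Hz.
    + destruct (proj1 (Hin z) (or_intror Hz)) as [<-|?]; [|assumption].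
      specialize (Hf1 _ Hz). lia.
    + destruct (proj2 (Hin z) (or_intror Hz)) as [<-|?]; [|assumption].
      specialize (Hf2 _ Hz). lia.
Qed.

Lemma StronglySorted_lt_NoDup (l : list nat) : StronglySorted lt l -> NoDup l.
Proof.
  induction 1 as [|x l Hs IH Hf]; constructor; [|assumption].
  rewrite Forall_forall in Hf. intros Hx. specialize (Hf _ Hx). lia.
Qed.

Lemma bst_iff_sorted (t : tree) : bst t <-> StronglySorted lt (keys t).
Proof.
  induction t as [|l IHl k r IHr]; simpl.
  - split; auto using SSorted_nil.
  - rewrite StronglySorted_middle. tauto.
Qed.

(** * Decomposition of a tree along a search path *)

(** The search path in increasing key order instead of root-to-[s] order, so that it lines up with
    [hanging] and with the in-order keys of the replacement tree. *)
Fixpoint spine (s : nat) (t : tree) : list nat :=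
  match t with
  | Leaf => []
  | Node l k r =>
      match Nat.compare s k with
      | Eq => [k]
      | Lt => spine s l ++ [k]
      | Gt => k :: spine s r
      end
  end.

Lemma spine_perm (s : nat) (t : tree) : Permutation (spine s t) (search_path s t).
Proof.
  induction t as [|l IHl k r IHr]; simpl; [constructor|].
  destruct (Nat.compare s k); auto.
  rewrite <- Permutation_cons_append. auto.
Qed.

Lemma spine_keys (s : nat) (t : tree) : incl (spine s t) (keys t).
Proof.
  induction t as [|l IHl k r IHr]; simpl; [easy|].
  intros x. destruct (Nat.compare s k); simpl; rewrite ?in_app_iff; simpl.
  - tauto.
  - intros [H|H]; [apply IHl in H|]; tauto.
  - intros [H|H]; [|apply IHr in H]; tauto.
Qed.

Lemma spine_sorted (s : nat) (t : tree) : bst t -> StronglySorted lt (spine s t).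
Proof.
  induction t as [|l IHl k r IHr]; simpl; [constructor|].
  intros (Hl & Hr & Bl & Br). destruct (Nat.compare s k).
  - apply (StronglySorted_middle [] []). repeat split; easy || constructor.
  - apply StronglySorted_middle. repeat split; auto; try easy; try constructor.
    intros x Hx. apply Hl, (spine_keys s l), Hx.
  - apply (StronglySorted_middle []). repeat split; auto; try easy; try constructor.
    intros x Hx. apply Hr, (spine_keys s r), Hx.
Qed.

Lemma length_hanging (s : nat) (t : tree) :
  length (hanging s t) = S (length (spine s t)).
Proof.
  induction t as [|l IHl k r IHr]; simpl; [reflexivity|].
  destruct (Nat.compare s k); simpl; rewrite ?length_app; simpl; lia.
Qed.

(** In-order reading of a grafted tree. It sees only the key list of the upper tree and not its
    shape, which is why an access preserves [keys]. The default [Leaf] is never reached when there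
    is one more tree than keys. *)
Fixpoint weave (ks : list nat) (ts : list tree) : list nat :=
  match ks with
  | [] => keys (hd Leaf ts)
  | k :: ks' => keys (hd Leaf ts) ++ k :: weave ks' (tl ts)
  end.

Lemma weave_app (ks1 ks2 : list nat) (k : nat) (ts : list tree) :
  weave (ks1 ++ k :: ks2) ts =
  weave ks1 (firstn (S (length ks1)) ts) ++ k :: weave ks2 (skipn (S (length ks1)) ts).
Proof.
  revert ts. induction ks1 as [|j ks1 IH]; intros ts.
  - destruct ts; reflexivity.
  - cbn [app weave length]. rewrite IH. rewrite <- app_assoc.
    destruct ts; reflexivity.
Qed.

Lemma keys_graft (a : tree) (ts : list tree) : keys (graft a ts) = weave (keys a) ts.
Proof.
  revert ts. induction a as [|l IHl k r IHr]; intros ts; [reflexivity|].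
  cbn [keys graft]. rewrite weave_app, IHl, IHr. reflexivity.
Qed.

Lemma keys_weave (s : nat) (t : tree) : keys t = weave (spine s t) (hanging s t).
Proof.
  induction t as [|l IHl k r IHr]; simpl; [reflexivity|].
  destruct (Nat.compare s k).
  - reflexivity.
  - rewrite weave_app, <- length_hanging, firstn_app, skipn_app, Nat.sub_diag.
    rewrite firstn_all, skipn_all. simpl. now rewrite app_nil_r, <- IHl.
  - simpl. now rewrite <- IHr.
Qed.

Fixpoint subtree (k : nat) (t : tree) : tree :=
  match t with
  | Leaf => Leaf
  | Node l x r =>
      match Nat.compare k x with
      | Eq => t
      | Lt => subtree k l
      | Gt => subtree k r
      end
  end.

(** At a proper ancestor of [k] on the path to [s], the keys [s] and [k] lie on the same side, hence
    so does every key between them; the descent to [k] therefore never discards [x]. *)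
Lemma subtree_between (s k x : nat) (t : tree) :
  bst t -> In k (spine s t) -> In x (keys t) ->
  s <= x <= k \/ k <= x <= s -> In x (keys (subtree k t)).
Proof.
  induction t as [|l IHl y r IHr]; simpl; [easy|].
  intros (Hl & Hr & Bl & Br) Hk Hx Hb.
  destruct (Nat.compare_spec s y) as [E|E|E].
  - destruct Hk as [<-|[]]. rewrite Nat.compare_refl. exact Hx.
  - apply in_app_iff in Hk. destruct Hk as [Hk|[<-|[]]].
    + assert (k < y) by (apply Hl, (spine_keys s l), Hk).
      rewrite (proj2 (Nat.compare_lt_iff k y)) by assumption.
      apply IHl; auto. apply in_app_iff in Hx.
      destruct Hx as [Hx|[<-|Hx]]; [assumption|lia|]. specialize (Hr _ Hx). lia.
    + rewrite Nat.compare_refl. exact Hx.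
  - destruct Hk as [<-|Hk].
    + rewrite Nat.compare_refl. exact Hx.
    + assert (y < k) by (apply Hr, (spine_keys s r), Hk).
      rewrite (proj2 (Nat.compare_gt_iff k y)) by assumption.
      apply IHr; auto. apply in_app_iff in Hx.
      destruct Hx as [Hx|[<-|Hx]]; [|lia|assumption]. specialize (Hl _ Hx). lia.
Qed.

(** * The sum-of-logarithms potential *)

Definition size (t : tree) : nat := length (keys t).

Fixpoint potential (t : tree) : R :=
  match t with
  | Leaf => 0
  | Node l _ r => potential l + Rlog 2 (INR (size t)) + potential r
  end%R.

Fixpoint sum {A : Type} (f : A -> R) (l : list A) : R :=
  match l with
  | [] => 0
  | x :: l' => f x + sum f l'
  end%R.

Lemma sum_app {A : Type} (f : A -> R) (l1 l2 : list A) :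
  sum f (l1 ++ l2) = (sum f l1 + sum f l2)%R.
Proof. induction l1 as [|x l1 IH]; simpl; lra. Qed.

Lemma sum_ext {A : Type} (f g : A -> R) (l : list A) :
  (forall x, In x l -> f x = g x) -> sum f l = sum g l.
Proof.
  induction l as [|x l IH]; simpl; intros H; [reflexivity|].
  rewrite H, IH; auto.
Qed.

Lemma potential_nonneg (t : tree) : (0 <= potential t)%R.
Proof.
  induction t as [|l IHl k r IHr]; cbn [potential]; [lra|].
  pose proof (log2_INR_nonneg (size (Node l k r))). lra.
Qed.

(** Keeping [n] apart from [size t] lets the induction use the same logarithm in both subtrees. *)
Lemma potential_le (t : tree) (n : nat) :
  size t <= n -> (potential t <= INR (size t) * Rlog 2 (INR n))%R.
Proof.
  induction t as [|l IHl k r IHr]; cbn [potential]; intros H; [simpl; lra|].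
  assert (E : size (Node l k r) = size l + S (size r)) by apply length_app.
  pose proof (log2_INR_le _ _ H). rewrite E in H.
  specialize (IHl ltac:(lia)). specialize (IHr ltac:(lia)).
  rewrite E at 2. rewrite plus_INR, S_INR. lra.
Qed.

Definition log_size (t : tree) (k : nat) : R := Rlog 2 (INR (size (subtree k t))).

(** Isolates the part of the potential that an access can change: the hanging subtrees are moved
    intact, so their potentials cancel between the old and the new tree. *)
Lemma potential_spine (s : nat) (t : tree) :
  bst t -> potential t = (sum (log_size t) (spine s t) + sum potential (hanging s t))%R.
Proof.
  induction t as [|l IHl k r IHr]; [simpl; intros; lra|].
  intros (Hl & Hr & Bl & Br). cbn [potential spine hanging].
  assert (Ek : log_size (Node l k r) k = Rlog 2 (INR (size (Node l k r)))).
  { unfold log_size. simpl. now rewrite Nat.compare_refl. }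
  destruct (Nat.compare s k).
  - cbn [sum]. rewrite Ek. lra.
  - rewrite !sum_app. cbn [sum]. rewrite Ek, IHl by assumption.
    rewrite (sum_ext (log_size (Node l k r)) (log_size l) (spine s l)); [lra|].
    intros x Hx. apply spine_keys, Hl, Nat.compare_lt_iff in Hx.
    unfold log_size. simpl. now rewrite Hx.
  - cbn [sum]. rewrite Ek, IHr by assumption.
    rewrite (sum_ext (log_size (Node l k r)) (log_size r) (spine s r)); [lra|].
    intros x Hx. apply spine_keys, Hr, Nat.compare_gt_iff in Hx.
    unfold log_size. simpl. now rewrite Hx.
Qed.

(* The grafted tree occupies the positions [c], ..., [c + size - 1] of an
   ambient key sequence, and [F j - F i] bounds the gain of a node whose new
   subtree occupies the positions [i], ..., [j - 1].  Since these differences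
   telescope along a level, every level of [a] contributes at most
   [F (c + size) - F c]. *)
Lemma potential_graft (F : nat -> R) (g : nat -> R) (a : tree) (ts : list tree) (c : nat) :
  (forall i j, i <= j -> (F i <= F j)%R) ->
  length ts = S (length (keys a)) ->
  (forall A k B i j,
     keys (graft a ts) = A ++ k :: B -> In k (keys a) ->
     c <= i -> i <= c + length A -> c + length A < j -> j <= c + size (graft a ts) ->
     (Rlog 2 (INR (j - i)) - g k + 2 <= F j - F i)%R) ->
  (potential (graft a ts) <=
     sum potential ts + sum g (keys a) - 2 * INR (length (keys a))
     + INR (levels a) * (F (c + size (graft a ts))%nat - F c))%R.
Proof.
  intros HF. revert ts c. induction a as [|l IHl k r IHr]; intros ts c Hlen H.
  - destruct ts as [|t [|]]; try discriminate. simpl. lra.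
  - cbn [keys graft] in *. rewrite length_app in Hlen. cbn [length] in Hlen.
    set (j := S (length (keys l))) in *.
    set (gl := graft l (firstn j ts)) in *. set (gr := graft r (skipn j ts)) in *.
    assert (E : size (Node gl k gr) = size gl + S (size gr)) by apply length_app.
    assert (Hl : (potential gl <= sum potential (firstn j ts) + sum g (keys l)
       - 2 * INR (length (keys l)) + INR (levels l) * (F (c + size gl)%nat - F c))%R).
    { apply IHl; [rewrite length_firstn; lia|].
      intros A k' B i' j' Ek Hk H1 H2 H3 H4. fold gl in Ek, H4.
      apply (H A k' (B ++ k :: keys gr)); try (assumption || lia).
      - rewrite Ek, <- app_assoc. reflexivity.
      - apply in_app_iff. now left. }
    assert (Hr : (potential gr <= sum potential (skipn j ts) + sum g (keys r)
       - 2 * INR (length (keys r))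
       + INR (levels r) * (F (c + S (size gl) + size gr)%nat - F (c + S (size gl))%nat))%R).
    { apply IHr; [rewrite length_skipn; lia|].
      intros A k' B i' j' Ek Hk H1 H2 H3 H4. fold gr in Ek, H4.
      apply (H (keys gl ++ k :: A) k' B).
      - rewrite Ek, <- app_assoc. reflexivity.
      - apply in_app_iff. right. now right.
      - lia.
      - rewrite length_app. cbn [length]. unfold size in *. lia.
      - rewrite length_app. cbn [length]. unfold size in *. lia.
      - lia. }
    assert (Hk := H (keys gl) k (keys gr) c (c + size (Node gl k gr)) eq_refl
                    ltac:(apply in_elt) ltac:(lia) ltac:(lia)
                    ltac:(fold (size gl); lia) ltac:(lia)).
    replace (c + size (Node gl k gr) - c) with (size (Node gl k gr)) in Hk by lia.
    rewrite <- (firstn_skipn j ts) at 1. cbn [potential levels].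
    rewrite !sum_app, length_app, plus_INR. cbn [sum length]. rewrite !S_INR.
    replace (c + S (size gl) + size gr) with (c + size (Node gl k gr)) in Hr by lia.
    assert (F1 := HF (c + size gl) (c + S (size gl)) ltac:(lia)).
    assert (F2 := HF c (c + size gl) ltac:(lia)).
    assert (F3 := HF (c + S (size gl)) (c + size (Node gl k gr)) ltac:(lia)).
    assert (M1 := le_INR _ _ (Nat.le_max_l (levels l) (levels r))).
    assert (M2 := le_INR _ _ (Nat.le_max_r (levels l) (levels r))).
    set (M := INR (Nat.max (levels l) (levels r))) in *.
    set (f0 := F c) in *. set (f1 := F (c + size gl)) in *.
    set (f2 := F (c + S (size gl))) in *. set (f3 := F (c + size (Node gl k gr))) in *.
    (* Raising both level counts to their maximum [M] and adding the nonnegative increment of [F]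
       across the root's position bounds the subtrees by [M * (f3 - f0)]; the root, which owns the
       whole interval, adds one more [f3 - f0]. *)
    assert (INR (levels l) * (f1 - f0) <= M * (f1 - f0))%R by (apply Rmult_le_compat_r; lra).
    assert (INR (levels r) * (f3 - f2) <= M * (f3 - f2))%R by (apply Rmult_le_compat_r; lra).
    assert (0 <= M * (f2 - f1))%R by (apply Rmult_le_pos; [apply pos_INR | lra]).
    lra.
Qed.

(** * Amortized analysis *)

(** The keys [s :: A] are distinct and lie between [s] and [k], so [subtree_between] places all of
    them in the old subtree of [k]. *)
Lemma subtree_size_right (s k : nat) (t : tree) (X A B : list nat) :
  bst t -> In k (spine s t) -> keys t = X ++ s :: A ++ k :: B ->
  S (length A) <= size (subtree k t).
Proof.
  intros Bt Hk E. assert (Hs := Bt). apply bst_iff_sorted in Hs. rewrite E in Hs.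
  apply StronglySorted_middle in Hs. destruct Hs as (_ & H1 & _ & Hs).
  apply StronglySorted_middle in Hs. destruct Hs as (H2 & _ & Hs & _).
  assert (s < k) by (apply H1, in_elt).
  apply (NoDup_incl_length (l := s :: A)).
  - constructor; [|now apply StronglySorted_lt_NoDup].
    intros Hin. assert (s < s) by (apply H1, in_app_iff; now left). lia.
  - intros x Hx. apply (subtree_between s); [assumption|assumption| |left].
    + rewrite E. destruct Hx as [<-|Hx]; [apply in_elt|].
      apply in_app_iff. right. right. apply in_app_iff. now left.
    + destruct Hx as [<-|Hx]; [lia|]. specialize (H2 x Hx).
      assert (s < x) by (apply H1, in_app_iff; now left). lia.
Qed.

Lemma subtree_size_left (s k : nat) (t : tree) (A B X : list nat) :
  bst t -> In k (spine s t) -> keys t = (A ++ k :: B) ++ s :: X ->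
  S (length B) <= size (subtree k t).
Proof.
  intros Bt Hk E. assert (Hs := Bt). apply bst_iff_sorted in Hs. rewrite E in Hs.
  apply StronglySorted_middle in Hs. destruct Hs as (H1 & _ & Hs & _).
  apply StronglySorted_middle in Hs. destruct Hs as (_ & H2 & _ & Hs).
  assert (k < s) by (apply H1, in_elt).
  assert (H3 : forall x, In x B -> x < s).
  { intros x Hx. apply H1, in_app_iff. right. now right. }
  apply (NoDup_incl_length (l := s :: B)).
  - constructor; [|now apply StronglySorted_lt_NoDup].
    intros Hin. specialize (H3 s Hin). lia.
  - intros x Hx. apply (subtree_between s); [assumption|assumption| |right].
    + rewrite E. destruct Hx as [<-|Hx]; [apply in_elt|].
      rewrite <- app_assoc. apply in_app_iff. right. right.
      apply in_app_iff. now left.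
    + destruct Hx as [<-|Hx]; [lia|]. specialize (H2 x Hx). specialize (H3 x Hx). lia.
Qed.

Lemma keys_eq_spine (s : nat) (t a : tree) :
  bst t -> bst a -> (forall x, In x (keys a) <-> In x (search_path s t)) ->
  keys a = spine s t.
Proof.
  intros Bt Ba Hin. apply StronglySorted_lt_ext.
  - now apply bst_iff_sorted.
  - now apply spine_sorted.
  - intros x. rewrite Hin. split; apply Permutation_in;
      [symmetry|]; apply spine_perm.
Qed.

Lemma step_keys (s : nat) (t t' : tree) :
  bst t -> path_balance_step s t t' -> keys t' = keys t.
Proof.
  intros Bt (a & Ba & Hin & _ & _ & ->).
  rewrite keys_graft, (keys_weave s t). f_equal.
  now apply keys_eq_spine.
Qed.

(** The two sides of the new root [s] are treated separately, with keys counted outward from [s].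
    Each side contributes 2 logarithms per level, whence the 4; the 1 is the new root's own
    logarithm, and the added 2 compensates for [s], the only path node without a gain. *)
Lemma step_potential (s : nat) (t t' : tree) :
  bst t -> path_balance_step s t t' ->
  (potential t' + 2 * INR (length (search_path s t)) <=
   potential t + 2 +
   (1 + 4 * INR (Nat.log2_up (1 + length (search_path s t)))) * Rlog 2 (INR (size t)))%R.
Proof.
  intros Bt Hstep. assert (Hkeys := step_keys _ _ _ Bt Hstep).
  destruct Hstep as (a & Ba & Hin & Hroot & Hdepth & ->).
  assert (Ea : keys a = spine s t) by now apply keys_eq_spine.
  destruct a as [|l k r]; [discriminate|]. injection Hroot as ->.
  rewrite (potential_spine s t Bt), <- Ea.
  rewrite <- (Permutation_length (spine_perm s t)), <- Ea in *.
  assert (Hlen := length_hanging s t). rewrite <- Ea in Hlen.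
  assert (Hspine : forall x, In x (keys (Node l s r)) -> In x (spine s t))
    by (now rewrite Ea).
  clear Ea. cbn [graft] in Hkeys |- *.
  set (ts := hanging s t) in *. set (g := log_size t) in *.
  cbn [keys] in *. rewrite length_app in *. cbn [length] in *.
  set (j := S (length (keys l))) in *.
  assert (Hsz := f_equal (@length nat) Hkeys).
  rewrite length_app in Hsz. cbn [length] in Hsz.
  set (gl := graft l (firstn j ts)) in *. set (gr := graft r (skipn j ts)) in *.
  fold (size gl) in Hsz. fold (size gr) in Hsz. fold (size t) in Hsz.
  assert (Hl : (potential gl <= sum potential (firstn j ts) + sum g (keys l)
     - 2 * INR (length (keys l))
     + INR (levels l) * (-2 * Rlog 2 (INR (S (size gl - (0 + size gl))))
                         - -2 * Rlog 2 (INR (S (size gl - 0)))))%R).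
  (* [S (size gl - i)] counts the keys from position [i] through [s]. It decreases in [i], so the
     sign is reversed to make [F] monotone. *)
  { apply (potential_graft (fun i => (-2 * Rlog 2 (INR (S (size gl - i))))%R)).
    - intros i i' Hi. pose proof (log2_INR_le (S (size gl - i')) (S (size gl - i)) ltac:(lia)).
      lra.
    - rewrite length_firstn. lia.
    - intros A k B i i' E Hk H1 H2 H3 H4. fold gl in E, H4.
      assert (Hf : S (length B) <= size (subtree k t)).
      { apply (subtree_size_left s k t A B (keys gr)); [assumption| |].
        - apply Hspine, in_app_iff. now left.
        - rewrite <- Hkeys, E. reflexivity. }
      apply (f_equal (@length nat)) in E. fold (size gl) in E.
      rewrite length_app in E. cbn [length] in E.
      pose proof (log2_gain (size (subtree k t)) (i' - i) (S (size gl - i')) (S (size gl - i))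
        ltac:(lia) ltac:(lia) ltac:(lia) ltac:(lia)).
      unfold g, log_size. lra. }
  assert (Hr : (potential gr <= sum potential (skipn j ts) + sum g (keys r)
     - 2 * INR (length (keys r))
     + INR (levels r) * (2 * Rlog 2 (INR (S (0 + size gr))) - 2 * Rlog 2 (INR 1)))%R).
  (* Here [S i] counts the keys from [s] up to but excluding position [i] of the right side. *)
  { apply (potential_graft (fun i => (2 * Rlog 2 (INR (S i)))%R)).
    - intros i i' Hi. pose proof (log2_INR_le (S i) (S i') ltac:(lia)). lra.
    - rewrite length_skipn. lia.
    - intros A k B i i' E Hk H1 H2 H3 H4. fold gr in E, H4.
      assert (Hf : S (length A) <= size (subtree k t)).
      { apply (subtree_size_right s k t (keys gl) A B); [assumption| |].
        - apply Hspine, in_app_iff. right. now right.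
        - rewrite <- Hkeys, E. reflexivity. }
      pose proof (log2_gain (size (subtree k t)) (i' - i) (S i) (S i')
        ltac:(lia) ltac:(lia) ltac:(lia) ltac:(lia)).
      unfold g, log_size. lra. }
  rewrite Nat.add_0_l, Nat.sub_diag, Nat.sub_0_r in Hl. rewrite Nat.add_0_l in Hr.
  change (INR 1) with 1%R in Hl, Hr. rewrite log2_1 in Hl, Hr.
  assert (Er : size (Node gl s gr) = size t).
  { rewrite <- Hsz. apply length_app. }
  cbn [potential]. rewrite Er, <- (firstn_skipn j ts) at 1.
  rewrite !sum_app, plus_INR, S_INR. cbn [sum].
  assert (Hg : (0 <= g s)%R) by apply log2_INR_nonneg.
  (* Depth counts edges, so the depth bound on the whole tree bounds the number of levels of each
     subtree of its root by [D]. *)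
  unfold depth in Hdepth. cbn [levels Nat.pred] in Hdepth.
  set (D := Nat.log2_up (1 + (length (keys l) + S (length (keys r))))) in *.
  assert (L1 := log2_INR_le (S (size gl)) (size t) ltac:(lia)).
  assert (L2 := log2_INR_le (S (size gr)) (size t) ltac:(lia)).
  assert (D1 := le_INR (levels l) D ltac:(lia)).
  assert (D2 := le_INR (levels r) D ltac:(lia)).
  assert (INR (levels l) * Rlog 2 (INR (S (size gl))) <= INR D * Rlog 2 (INR (size t)))%R
    by (apply Rmult_le_compat; auto using pos_INR, log2_INR_nonneg).
  assert (INR (levels r) * Rlog 2 (INR (S (size gr))) <= INR D * Rlog 2 (INR (size t)))%R
    by (apply Rmult_le_compat; auto using pos_INR, log2_INR_nonneg).
  lra.
Qed.

(** From [8 <= 9] one gets [log2 3 >= 3/2], whose square exceeds 2. A positive lower bound is what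
    allows multiples of [log2 n] to be absorbed into [log2 n * log2 (log2 n)]. *)
Lemma log2_log2_ge_half (n : nat) : 3 <= n -> (1 / 2 <= Rlog 2 (Rlog 2 (INR n)))%R.
Proof.
  intros Hn.
  pose proof (log2_pow 1) as E1. simpl in E1. replace (2 * 1)%R with 2%R in E1 by lra.
  assert (E3 := log2_pow 3). replace (INR 3) with 3%R in E3 by (simpl; lra).
  assert (H3 : (3 / 2 <= Rlog 2 3)%R).
  { assert (H : (Rlog 2 (2 ^ 3) <= Rlog 2 (3 * 3))%R) by (apply log2_le; lra).
    rewrite E3, log2_mult in H by lra. lra. }
  assert (Hl := log2_INR_le 3 n Hn). replace (INR 3) with 3%R in Hl by (simpl; lra).
  set (L := Rlog 2 (INR n)) in *.
  assert (H : (Rlog 2 2 <= Rlog 2 (L * L))%R) by (apply log2_le; nra).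
  rewrite log2_mult in H by lra. lra.
Qed.

(** Of the two copies of the path length in [step_potential], one is the cost and the other absorbs
    the term with the logarithm of the path length. *)
Lemma step_amortized (s : nat) (t t' : tree) :
  bst t -> 3 <= size t -> In s (keys t) -> path_balance_step s t t' ->
  (INR (length (search_path s t)) + potential t' <=
   potential t + 50 * (Rlog 2 (INR (size t)) * Rlog 2 (Rlog 2 (INR (size t)))))%R.
Proof.
  intros Bt Hn Hs Hstep. assert (H := step_potential _ _ _ Bt Hstep).
  assert (Hp : 1 <= length (search_path s t)).
  { destruct t as [|l k r]; [destruct Hs|]. simpl. destruct (Nat.compare s k); simpl; lia. }
  assert (Hup := log2_up_bound _ Hp). assert (Hh := log2_log2_ge_half _ Hn).
  assert (HL : (1 <= Rlog 2 (INR (size t)))%R).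
  { assert (H1 := log2_pow 1). change (2 ^ 1)%R with (2 * 1)%R in H1.
    replace (2 * 1)%R with (INR 2) in H1 by (simpl; lra).
    change (INR 1) with 1%R in H1. rewrite <- H1. apply log2_INR_le. lia. }
  set (L := Rlog 2 (INR (size t))) in *. set (M := Rlog 2 L) in *.
  set (p := INR (length (search_path s t))) in *.
  assert (0 < p)%R by (apply lt_0_INR; lia).
  (* [log p = log (p / 8L) + 3 + log L], and the first term is at most [p / 4L]. *)
  assert (Hlog : (4 * L * Rlog 2 p <= p + 4 * L * (3 + M))%R).
  { assert (E : p = (2 ^ 3 * L * (p / (8 * L)))%R) by (field; lra).
    assert (0 < p / (8 * L))%R by (apply Rdiv_lt_0_compat; lra).
    rewrite E at 1. rewrite !log2_mult, log2_pow by lra. fold M.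
    assert (Hd := log2_le_double (p / (8 * L)) ltac:(assumption)).
    assert (4 * L * Rlog 2 (p / (8 * L)) <= 4 * L * (2 * (p / (8 * L))))%R
      by (apply Rmult_le_compat_l; lra).
    replace (4 * L * (2 * (p / (8 * L))))%R with p in * by (field; lra).
    simpl INR. lra. }
  assert (L * INR (Nat.log2_up (1 + length (search_path s t))) <= L * (2 + Rlog 2 p))%R
    by (apply Rmult_le_compat_l; lra).
  (* What remains is [2 + 21 * L + 4 * L * M]. Since [L >= 1] and [M >= 1/2], it is at most
     [23 * L + 4 * L * M <= 50 * L * M]. *)
  assert (L * (1 / 2) <= L * M)%R by (apply Rmult_le_compat_l; lra).
  lra.
Qed.

Lemma run_amortized (t : tree) (ss : list nat) (c : nat) :
  path_balance_run t ss c -> bst t -> 3 <= size t -> incl ss (keys t) ->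
  (INR c <= potential t + INR (length ss) *
     (50 * (Rlog 2 (INR (size t)) * Rlog 2 (Rlog 2 (INR (size t))))))%R.
Proof.
  induction 1 as [t|s ss t t' c Hstep Hrun IH]; intros Bt Hn Hss.
  - pose proof (potential_nonneg t). simpl. lra.
  - assert (Hk := step_keys _ _ _ Bt Hstep).
    apply incl_cons_inv in Hss. destruct Hss as [Hs Hss].
    assert (H := step_amortized _ _ _ Bt Hn Hs Hstep).
    unfold size in IH. rewrite bst_iff_sorted, Hk in IH.
    rewrite <- bst_iff_sorted in IH. specialize (IH Bt Hn Hss). fold (size t) in IH.
    cbn [length]. rewrite plus_INR, S_INR. lra.
Qed.

Lemma bst_on_size (n : nat) (t : tree) : bst_on n t -> size t = n.
Proof.
  intros [Bt Hin]. rewrite <- (length_seq n 1). apply Permutation_length, NoDup_Permutation.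
  - now apply StronglySorted_lt_NoDup, bst_iff_sorted.
  - apply seq_NoDup.
  - intros x. rewrite Hin, in_seq. lia.
Qed.

(** The range starts at [n = 3] because at [n = 2] the iterated logarithm is 0 and the bound would
    force zero cost, although every access costs at least 1. *)
Theorem theorem5 :
  exists K0 : R,
    forall (n : nat), 3 <= n ->
    forall (t0 : tree) (accesses : list nat) (cost : nat),
      bst_on n t0 ->
      (forall s, In s accesses -> 1 <= s <= n) ->
      path_balance_run t0 accesses cost ->
      (INR cost <=
         K0 * (INR n + INR (length accesses))
            * Rlog 2 (INR n) * Rlog 2 (Rlog 2 (INR n)))%R.
Proof.
  exists 50%R. intros n Hn t ss c Ht Hss Hrun.
  assert (Hsize := bst_on_size _ _ Ht). destruct Ht as [Bt Hin].
  assert (H := run_amortized _ _ _ Hrun Bt ltac:(lia)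
                 ltac:(intros s Hs; apply Hin, Hss, Hs)).
  assert (Hpot := potential_le t n ltac:(lia)).
  rewrite Hsize in *.
  assert (Hh := log2_log2_ge_half n Hn).
  assert (0 <= Rlog 2 (INR n))%R by apply log2_INR_nonneg.
  assert (0 <= INR n * Rlog 2 (INR n))%R by (apply Rmult_le_pos; auto using pos_INR).
  set (L := Rlog 2 (INR n)) in *.
  (* The initial potential is at most [n * L <= 2 * n * L * log2 L], well within the [50 * n] share
     of the bound. *)
  assert (INR n * L * (1 / 2) <= INR n * L * Rlog 2 L)%R by (apply Rmult_le_compat_l; lra).
  lra.
Qed.
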